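(* If $x=(x_1,\dots,x_n)\in S(A,b)$, then there is an $x^*\in\check S(A,b)$ satisfying $x^*\le x$.
   Context: Let $I=\{1,\dots,m\}$, $J=\{1,\dots,n\}$, $A=(a_{ij})_{m\times n}$ with $a_{ij}\in[0,1]$, and $b=(b_1,\dots,b_m)$ with $b_i>0$ real. The Łukasiewicz t-norm is $T_L(a,x)=\max\{a+x-1,0\}$ on $[0,1]^2$. The solution set is $S(A,b)=\{x\in[0,1]^n : \sum_{j\in J}T_L(a_{ij},x_j)\ge b_i \text{ for all } i\in I\}$. Vectors are ordered componentwise. A solution $\check x\in S(A,b)$ is minimal if $x\in S(A,b)$ and $x\le\check x$ imply $x=\check x$; $\check S(A,b)$ is the set of all minimal solutions. *)

(* Defs.v *)
From mathcomp Require Import all_boot all_order all_algebra.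
From mathcomp Require Import classical_sets reals.

Set Implicit Arguments.
Unset Strict Implicit.
Unset Printing Implicit Defensive.

Import Order.TTheory GRing.Theory Num.Theory.

Local Open Scope classical_set_scope.
Local Open Scope ring_scope.

(* Meaningful for a, x in [0, 1]; defined on all of R to avoid subtypes. *)
Definition lukasiewicz (R : realType) (a x : R) : R := Num.max (a + x - 1) 0.

Definition le_vec (R : realType) (n : nat) (x y : 'rV[R]_n) : Prop :=
  forall j : 'I_n, x 0 j <= y 0 j.

Definition solutions (R : realType) (m n : nat)
    (A : 'M[R]_(m, n)) (b : 'rV[R]_m) : set 'rV[R]_n :=
  [set x | (forall j : 'I_n, 0 <= x 0 j <= 1) /\
           (forall i : 'I_m,
              b 0 i <= \sum_(j < n) lukasiewicz (A i j) (x 0 j))].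

Definition minimal_solutions (R : realType) (m n : nat)
    (A : 'M[R]_(m, n)) (b : 'rV[R]_m) : set 'rV[R]_n :=
  [set z | solutions A b z /\
           (forall x : 'rV[R]_n, solutions A b x -> le_vec x z -> x = z)].

(* Main.v *)
(* Lower the coordinates one at a time, each to the least value that keeps the
   vector a solution. That least value exists because the constraints on a single
   coordinate amount to finitely many closed lower bounds. Since T_L is monotone,
   lowering the other coordinates later cannot make room below it, so the vector
   obtained after the last coordinate is minimal. *)
Require Import Defs.
From mathcomp Require Import all_boot all_order all_algebra.
From mathcomp Require Import classical_sets reals.
From mathcomp Require Import lra.

Import Order.TTheory GRing.Theory Num.Theory.

Local Open Scope classical_set_scope.
Local Open Scope ring_scope.

Lemma lukasiewicz_le (R : realType) (a x y : R) :
  x <= y -> lukasiewicz a x <= lukasiewicz a y.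
Proof.
by move=> xy; rewrite /lukasiewicz ge_max !le_max lexx orbT andbT lerD2r lerD2l xy.
Qed.

(** As [lukasiewicz] is nonnegative, a demand [c <= 0] is vacuous; a positive one can only be met by
    the linear branch of the maximum. *)
Lemma le_lukasiewicz (R : realType) (a c x : R) :
  (c <= lukasiewicz a x) = (0 < c) ==> (c + 1 - a <= x).
Proof.
rewrite /lukasiewicz le_max; have [c0|c0] := ltP 0 c => /=; last exact: orbT.
by rewrite orbF; apply/idP/idP => h; lra.
Qed.

Lemma le_vec_trans (R : realType) (n : nat) (x y z : 'rV[R]_n) :
  le_vec x y -> le_vec y z -> le_vec x z.
Proof. by move=> xy yz j; exact: le_trans (xy j) (yz j). Qed.

Lemma solutions_minimal_coord (R : realType) (m n : nat)
    (A : 'M[R]_(m, n)) (b : 'rV[R]_m) (x : 'rV[R]_n) (j : 'I_n) :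
  solutions A b x ->
  exists y, [/\ solutions A b y, le_vec y x &
    forall z, solutions A b z -> le_vec z y -> z 0 j = y 0 j].
Proof.
move=> solx; have [x01 xb] := solx.
pose rest (z : 'rV[R]_n) i := \sum_(k < n | k != j) lukasiewicz (A i k) (z 0 k).
pose c i := b 0 i - rest x i.
(* [c i] is what coordinate [j] must contribute to row [i]. The default 0 accounts for the
   constraint [0 <= z 0 j]. *)
pose t := \big[Num.max/0]_(i < m | 0 < c i) (c i + 1 - A i j).
(* Below [x] the other coordinates contribute at most [rest x i], so coordinate [j] must still
   supply [c i]. *)
have t_le z : solutions A b z -> le_vec z x -> t <= z 0 j.
  move=> [z01 zb] zx; apply/bigmax_leP; split=> [|i ci0].
    by case/andP: (z01 j).
  apply: (implyP _ ci0); rewrite -le_lukasiewicz lerBlDr.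
  apply: le_trans (zb i) _; rewrite (bigD1 j) //= lerD2l.
  by apply: ler_sum => k _; exact: lukasiewicz_le.
pose y := \row_k (if k == j then t else x 0 k).
have yj : y 0 j = t by rewrite mxE eqxx.
have tx : t <= x 0 j by exact: t_le.
have yx : le_vec y x by move=> k; rewrite mxE; case: eqP => [->|].
exists y; split=> //; last first.
  move=> z solz zy; apply/le_anti; rewrite zy yj.
  by apply: t_le => //; exact: le_vec_trans zy yx.
split=> [k|i].
  rewrite (le_trans (yx k)) ?andbT; last by case/andP: (x01 k).
  rewrite mxE; case: eqP => _; first exact: bigmax_ge_id.
  by case/andP: (x01 k).
rewrite (bigD1 j) //= yj.
have -> : \sum_(k < n | k != j) lukasiewicz (A i k) (y 0 k) = rest x i.
  by apply: eq_bigr => k /negbTE kj; rewrite mxE kj.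
rewrite -lerBlDr le_lukasiewicz; apply/implyP => ci0.
exact: (le_bigmax_cond _ (fun i => c i + 1 - A i j)).
Qed.

(** Minimality at [j] is stated against every solution below [y], so it survives further lowering
    and induction on [s] applies. *)
Lemma solutions_minimal_coords (R : realType) (m n : nat)
    (A : 'M[R]_(m, n)) (b : 'rV[R]_m) (x : 'rV[R]_n) (s : seq 'I_n) :
  solutions A b x ->
  exists y, [/\ solutions A b y, le_vec y x &
    forall j z, j \in s -> solutions A b z -> le_vec z y -> z 0 j = y 0 j].
Proof.
move=> solx; elim: s => [|j s [y [soly yx ymin]]]; first by exists x; split.
have [w [solw wy wmin]] := @solutions_minimal_coord _ _ _ A b y j soly.
exists w; split=> //; first exact: le_vec_trans wy yx.
move=> k z; rewrite inE => /predU1P[->|ks] solz zw; first exact: wmin.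
(* Both [z] and [w] are solutions below [y], hence agree with it at [k]. *)
by rewrite (ymin k z) ?(ymin k w) //; exact: le_vec_trans zw wy.
Qed.

Theorem theorem4p2 (R : realType) (m n : nat)
    (A : 'M[R]_(m, n)) (b : 'rV[R]_m)
    (hA : forall (i : 'I_m) (j : 'I_n), 0 <= A i j <= 1)
    (hb : forall i : 'I_m, 0 < b 0 i)
    (x : 'rV[R]_n) (hx : solutions A b x) :
  exists2 xs : 'rV[R]_n, minimal_solutions A b xs & le_vec xs x.
Proof.
have [y [soly yx ymin]] := @solutions_minimal_coords _ _ _ A b x (enum 'I_n) hx.
exists y => //; split=> // z solz zy.
by apply/rowP => j; apply: ymin => //; rewrite mem_enum.
Qed.
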